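(* Let $d\in\mathbb{N}$ and let $\tau\ge d+1$ be given. Then for all $n\in\mathbb{N}$ with $n\ge\tau^4$, all $\boldsymbol{p}\in\mathscr{P}_\tau$ and all $\boldsymbol{k}\in\mathscr{B}_{n,\boldsymbol{p}}$, $$\log\left\{\frac{P_{n,\boldsymbol{p}}(\boldsymbol{k})}{n^{-d/2}\,\phi_{\Sigma_{\boldsymbol{p}}}(\boldsymbol{\delta}_{\boldsymbol{k},\boldsymbol{p}})}\right\}=n^{-1/2}\sum_{i=1}^{d+1}\left(\frac{1}{6p_i^2}\,\delta_{k_i,p_i}^3-\frac{1}{2p_i}\,\delta_{k_i,p_i}\right)+R_{n,\boldsymbol{p}}(\boldsymbol{k}),$$ where the error $R_{n,\boldsymbol{p}}(\boldsymbol{k})$ satisfies $$|R_{n,\boldsymbol{p}}(\boldsymbol{k})|\le n^{-1}\sum_{i=1}^{d+1}\left(\frac{21}{p_i^3}\,|\delta_{k_i,p_i}|^4+\frac{10}{p_i^2}\,|\delta_{k_i,p_i}|^2+\frac{2\tau}{3}\right).$$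
   Context: Notation. $\|\boldsymbol{s}\|_1=\sum_{i=1}^d|s_i|$; $\mathcal{S}_d=\{\boldsymbol{s}\in[0,1]^d:\|\boldsymbol{s}\|_1\le 1\}$ and $\mathcal{S}_d^o=\{\boldsymbol{s}\in(0,1)^d:\|\boldsymbol{s}\|_1<1\}$. For $\boldsymbol{p}=(p_1,\dots,p_d)$ in the simplex, $p_{d+1}:=1-\|\boldsymbol{p}\|_1$ (likewise $s_{d+1}:=1-\|\boldsymbol{s}\|_1$); for $\boldsymbol{k}\in\mathbb{N}_0^d\cap n\mathcal{S}_d$, $k_{d+1}:=n-\|\boldsymbol{k}\|_1$. The multinomial probability mass function is $P_{n,\boldsymbol{p}}(\boldsymbol{k})=\frac{n!}{\prod_{i=1}^{d+1}k_i!}\prod_{i=1}^{d+1}p_i^{k_i}$ for $\boldsymbol{k}\in\mathbb{N}_0^d\cap n\mathcal{S}_d$. $\Sigma_{\boldsymbol{p}}:=\mathrm{diag}(\boldsymbol{p})-\boldsymbol{p}\boldsymbol{p}^\top$ (a $d\times d$ matrix with determinant $\prod_{i=1}^{d+1}p_i$), and $\phi_{\Sigma_{\boldsymbol{p}}}(\boldsymbol{y})=\frac{\exp(-\frac12\boldsymbol{y}^\top\Sigma_{\boldsymbol{p}}^{-1}\boldsymbol{y})}{\sqrt{(2\pi)^d\prod_{i=1}^{d+1}p_i}}$ for $\boldsymbol{y}\in\mathbb{R}^d$. For $y\in\mathbb{R}$ and $1\le i\le d+1$, $\delta_{y,p_i}:=\frac{y-np_i}{\sqrt n}$, and $\boldsymbol{\delta}_{\boldsymbol{y},\boldsymbol{p}}:=(\delta_{y_1,p_1},\dots,\delta_{y_d,p_d})^\top$.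 $\mathscr{P}_\tau:=\{\boldsymbol{s}\in\mathcal{S}_d^o:\max_{1\le i\le d+1}s_i^{-1}\le\tau\}$ and $\mathscr{B}_{n,\boldsymbol{p}}:=\left\{\boldsymbol{k}\in\mathbb{N}_0^d\cap n\mathcal{S}_d^o:\max_{1\le i\le d+1}\left|\frac{\delta_{k_i,p_i}}{\sqrt n\,p_i}\right|\le\tau\sqrt{\frac{\log n}{n}}\right\}$. *)

(* Defs.v *)
From mathcomp Require Import all_boot all_order all_algebra.
From mathcomp Require Import all_classical all_reals all_analysis.

Set Implicit Arguments.
Unset Strict Implicit.
Unset Printing Implicit Defensive.

Import Order.TTheory GRing.Theory Num.Theory.
Local Open Scope classical_set_scope.
Local Open Scope ring_scope.

(* (s_1, ..., s_d) followed by an extra coordinate t; the index i of the text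
   is i.-1 : 'I_d.+1, so that the index d + 1 is ord_max. *)
Definition extend (T : Type) (d : nat) (s : 'cV[T]_d) (t : T) (i : 'I_d.+1) : T :=
  if unlift ord_max i is Some j then s j 0 else t.

Definition norm1 (R : realType) (d : nat) (s : 'cV[R]_d) : R :=
  \sum_(i < d) `|s i 0|.

Definition simplex_interior (R : realType) (d : nat) : set 'cV[R]_d :=
  [set s : 'cV[R]_d | (forall i, 0 < s i 0 < 1) /\ norm1 s < 1].

(* (s_1, ..., s_d, s_(d+1)) with s_(d+1) = 1 - |s|_1 *)
Definition prob_ext (R : realType) (d : nat) (s : 'cV[R]_d) : 'I_d.+1 -> R :=
  extend s (1 - norm1 s).

(* (k_1, ..., k_d, k_(d+1)) with k_(d+1) = n - |k|_1; the subtraction is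
   truncated, hence only meaningful if |k|_1 <= n. *)
Definition count_ext (d n : nat) (k : 'cV[nat]_d) : 'I_d.+1 -> nat :=
  extend k (n - \sum_(i < d) k i ord0)%N.

Definition multinomial_pmf (R : realType) (d n : nat) (p : 'cV[R]_d)
    (k : 'cV[nat]_d) : R :=
  n`!%:R / (\prod_(i < d.+1) (count_ext n k i)`!%:R) *
  \prod_(i < d.+1) prob_ext p i ^+ count_ext n k i.

Definition Sigma (R : realType) (d : nat) (p : 'cV[R]_d) : 'M[R]_d :=
  diag_mx p^T - p *m p^T.

Definition gauss_density (R : realType) (d : nat) (p y : 'cV[R]_d) : R :=
  expR (- 2^-1 * (y^T *m invmx (Sigma p) *m y) 0 0) /
  Num.sqrt ((2 * pi) ^+ d * \prod_(i < d.+1) prob_ext p i).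

Definition delta (R : realType) (n : nat) (y q : R) : R :=
  (y - n%:R * q) / Num.sqrt n%:R.

Definition delta_vec (R : realType) (d n : nat) (y p : 'cV[R]_d) : 'cV[R]_d :=
  \col_i delta n (y i 0) (p i 0).

Definition delta_ext (R : realType) (d n : nat) (k : 'cV[nat]_d)
    (p : 'cV[R]_d) (i : 'I_d.+1) : R :=
  delta n (count_ext n k i)%:R (prob_ext p i).

Definition real_vec (R : realType) (d : nat) (k : 'cV[nat]_d) : 'cV[R]_d :=
  map_mx (fun m : nat => m%:R) k.

(* In the two maxima below all the terms are nonnegative (in the first one
   because s is in the open simplex), so the default value 0 is harmless. *)
Definition param_set (R : realType) (d : nat) (tau : R) : set 'cV[R]_d :=
  [set s : 'cV[R]_d | simplex_interior s /\
           \big[Num.max/0]_(i < d.+1) (prob_ext s i)^-1 <= tau].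

Definition bulk (R : realType) (d : nat) (tau : R) (n : nat) (p : 'cV[R]_d) :
    set 'cV[nat]_d :=
  [set k : 'cV[nat]_d |
           ((fun s : 'cV[R]_d => n%:R *: s) @` (@simplex_interior R d))
             (real_vec R k) /\
           \big[Num.max/0]_(i < d.+1)
             `|delta_ext n k p i / (Num.sqrt n%:R * prob_ext p i)|
           <= tau * Num.sqrt (ln n%:R / n%:R)].

(* Main.v *)
Require Import Defs.
From mathcomp Require Import all_boot all_order all_algebra.
From mathcomp Require Import all_classical all_reals all_analysis.
From mathcomp Require Import ring lra.

Import Order.TTheory GRing.Theory Num.Theory.
Local Open Scope classical_set_scope.
Local Open Scope ring_scope.

(** Put u_i = (k_i - n p_i) / (n p_i), so that k_i = n p_i (1 + u_i),
    delta_i = sqrt n p_i u_i, and the n p_i u_i add up to 0.  Write Stirling's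
    formula as
      ln m! = (m + 1/2) ln m - m + ln (2 pi) / 2 + e_m,  0 <= e_m <= 1/(12 m),
    and use it for n and for every k_i.  The Gaussian exponent is
    -1/2 sum_i delta_i^2 / p_i = -1/2 sum_i n p_i u_i^2 over all d + 1
    coordinates, because Sigma_p^-1 = diag(1/p) + 11^T / p_(d+1) and the
    delta_i add up to 0.  All powers of n and 2 pi and the factors sqrt p_i
    then cancel, and the logarithm of the ratio is exactly
      e_n - sum_i e_(k_i)
        - sum_i n p_i ((1 + u_i) ln (1 + u_i) - u_i - u_i^2 / 2)
        - 1/2 sum_i ln (1 + u_i).
    The cubic term -u^3/6 of (1 + u) ln (1 + u) and the linear term of
    ln (1 + u) give the main term of the expansion ([log_ratio_eq]); their
    remainders are bounded by multiples of u^4 and u^2, which are the sums of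
    delta_i^4 / p_i^3 and delta_i^2 / p_i^2 ([norm_entropy_remainder],
    [norm_ln1D_sub]).

    The hypothesis tau^4 <= n keeps u_i away from -1: in the bulk,
    u_i^2 <= tau^2 ln n / n <= ln n / sqrt n <= 2/e < (7/8)^2
    ([rel_dev_le]).  Therefore k_i >= n p_i / 8 >= n / (8 tau), and
    e_(k_i) <= 1/(12 k_i) <= 2 tau / (3 n), which is the constant term of the
    error bound.

    The bounds on e_m ([stirling_bounds]) come from two facts.  The difference
    e_m - e_(m+1) = (m + 1/2) ln (1 + 1/m) - 1 lies between 0 and
    1/(12 m) - 1/(12 (m+1)), so that e_m decreases and e_m - 1/(12 m)
    increases.  Wallis' estimate of the central binomial coefficient makes
    e_(2m) - 2 e_m, hence e_m, of order 1/m; both monotone sequences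
    therefore tend to 0. *)

(** * Derivatives and monotonicity *)

Section Calculus.
Context {R : realType}.
Implicit Types f g df : R -> R.

(** [is_derive] is a type class: instance search would choose the shape of the
    derivative before the rules below are applied. *)
Definition derives (f : R -> R) (x d : R) : Prop := is_derive x 1 f d.

Lemma derives_eq f (x d d' : R) : derives f x d' -> d' = d -> derives f x d.
Proof. by move=> ? <-. Qed.

Lemma derives_cst (c x : R) : derives (fun=> c) x 0.
Proof. exact: is_derive_cst. Qed.

Lemma derives_id (x : R) : derives id x 1.
Proof. exact: is_derive_id. Qed.

Lemma derives_sin (x : R) : derives sin x (cos x).
Proof. exact: is_derive_sin. Qed.

Lemma derives_cos (x : R) : derives cos x (- sin x).
Proof. exact: is_derive_cos. Qed.

Lemma derivesD f g (x df dg : R) : derives f x df -> derives g x dg ->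
  derives (fun t => f t + g t) x (df + dg).
Proof. by move=> *; exact: is_deriveD. Qed.

Lemma derivesN f (x df : R) : derives f x df ->
  derives (fun t => - f t) x (- df).
Proof. by move=> *; exact: is_deriveN. Qed.

Lemma derivesM f g (x df dg : R) : derives f x df -> derives g x dg ->
  derives (fun t => f t * g t) x (f x * dg + g x * df).
Proof. by move=> *; exact: is_deriveM. Qed.

Lemma derivesX f n (x df : R) : derives f x df ->
  derives (fun t => f t ^+ n.+1) x (n.+1%:R * f x ^+ n * df).
Proof.
move=> hf; have := @is_deriveX _ _ f n.+1 x 1 df hf.
rewrite (_ : f ^+ n.+1 = fun t => f t ^+ n.+1) //.
by apply/funext => t; rewrite fctE.
Qed.

Lemma derivesV f (x df : R) : f x != 0 -> derives f x df ->
  derives (fun t => (f t)^-1) x (- (f x) ^- 2 * df).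
Proof. by move=> fx0 hf; exact: (is_deriveV fx0). Qed.

Lemma derives_ln f (x df : R) : 0 < f x -> derives f x df ->
  derives (fun t => ln (f t)) x ((f x)^-1 * df).
Proof.
by move=> fx0 hf; have hl := is_derive1_ln fx0; exact: is_derive1_comp.
Qed.

Lemma derives_le f df (a b : R) : a <= b ->
  (forall x, a <= x <= b -> derives f x (df x)) ->
  (forall x, a <= x <= b -> 0 <= df x) -> f a <= f b.
Proof.
move=> ab hf df0.
have hoo x : x \in `]a, b[%R -> is_derive x 1 f (df x).
  move=> xab; apply: hf.
  by move: xab; rewrite in_itv /= => /andP[/ltW -> /ltW ->].
have [|x xab e] := MVT_segment ab hoo.
  apply: derivable_within_continuous => x xab.
  by case: (hf x) => //; move: xab; rewrite in_itv.
by rewrite -subr_ge0 e mulr_ge0 ?subr_ge0 // df0 //; move: xab; rewrite in_itv.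
Qed.

End Calculus.

Ltac derive_rules :=
  repeat first [ exact: derives_cst | exact: derives_id
               | exact: derives_sin | exact: derives_cos
               | apply: derivesD | apply: derivesN | apply: derivesX
               | apply: derivesM | apply: derivesV | apply: derives_ln ].

(** * Wallis' product *)

Section Wallis.
Context {R : realType}.

(** The reduction formula for the integral of sin^n, read as a primitive: the
    Wallis integrals are then differences of values, and their recurrence is
    obtained by evaluation at 0 and pi/2. *)
Fixpoint sin_primitive (n : nat) : R -> R :=
  match n with
  | 0 => id
  | 1 => fun x => - cos x
  | n'.+2 => fun x =>
      (n'.+1%:R * sin_primitive n' x - cos x * sin x ^+ n'.+1) * n'.+2%:R^-1
  end.

Lemma sin_primitiveP (n : nat) (x : R) :
  derives (sin_primitive n) x (sin x ^+ n).
Proof.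
(* The recursion of [sin_primitive] has step two. *)
suff [] : derives (sin_primitive n) x (sin x ^+ n) /\
          derives (sin_primitive n.+1) x (sin x ^+ n.+1) by [].
elim: n => [|n [ihn ihn1]].
  split; first by rewrite expr0; exact: derives_id.
  by apply: derives_eq; [derive_rules | rewrite opprK expr1].
split=> //=; apply: derives_eq; first by derive_rules; exact: ihn.
have c2 : cos x ^+ 2 = 1 - sin x ^+ 2 :> R by rewrite -(cos2Dsin2 x); ring.
rewrite !exprS !mulr0 !addr0 !add0r.
have n0 : n%:R + 2 != 0 :> R by rewrite -natrD pnatr_eq0 addn2.
rewrite -(addn2 n) -(addn1 n) !natrD.
transitivity ((n%:R + 2)^-1 *
  ((n%:R + 1) * (1 - cos x ^+ 2) + sin x ^+ 2) * sin x ^+ n); first by ring.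
by rewrite c2; field.
Qed.

(** The integral of sin^n over [0, pi/2]. *)
Definition wallis n : R := sin_primitive n (pi / 2) - sin_primitive n 0.

Lemma wallis0 : wallis 0 = pi / 2.
Proof. by rewrite /wallis /= subr0. Qed.

Lemma wallis1 : wallis 1 = 1.
Proof. by rewrite /wallis /= cos_pihalf cos0; ring. Qed.

Lemma wallisSS n : wallis n.+2 = n.+1%:R / n.+2%:R * wallis n.
Proof.
by rewrite /wallis /= cos_pihalf sin0 expr0n /=; ring.
Qed.

(** The integrand sin^n decreases with n on [0, pi/2]. *)
Lemma wallis_le n : wallis n.+1 <= wallis n.
Proof.
have pi0 : (0 : R) <= pi / 2 by rewrite divr_ge0 ?pi_ge0.
have := @derives_le R (fun t => sin_primitive n t + - sin_primitive n.+1 t)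
  (fun t => sin t ^+ n + - sin t ^+ n.+1) 0 (pi / 2) pi0.
rewrite /wallis => h.
suff : sin_primitive n 0 + - sin_primitive n.+1 0 <=
       sin_primitive n (pi / 2) + - sin_primitive n.+1 (pi / 2) :> R by lra.
apply: h => x /andP[x0 x1].
  by apply: derivesD; [|apply: derivesN]; exact: sin_primitiveP.
have s0 : 0 <= sin x.
  by apply: sin_ge0_pi; rewrite x0 /=; have := @pi_ge0 R; lra.
rewrite exprSr -{1}(mulr1 (sin x ^+ n)) -mulrBr.
by rewrite mulr_ge0 ?exprn_ge0 ?subr_ge0 ?sin_le1.
Qed.

Lemma wallis_gt0 n : 0 < wallis n.
Proof.
suff [] : 0 < wallis n /\ 0 < wallis n.+1 by [].
elim: n => [|n [ihn ihn1]].
  by rewrite wallis0 wallis1 divr_gt0 ?pi_gt0.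
by split=> //; rewrite wallisSS mulr_gt0 // divr_gt0.
Qed.

(** By the recurrence, n W_n W_(n-1) does not depend on n; its value for
    n = 1 brings in pi.  With the monotonicity of W it encloses W_n^2. *)
Lemma wallis_mul n : n.+1%:R * wallis n.+1 * wallis n = pi / 2.
Proof.
elim: n => [|n ihn]; first by rewrite wallis0 wallis1; ring.
rewrite -ihn wallisSS; field.
by rewrite -natrD pnatr_eq0.
Qed.

Lemma wallis_double m :
  wallis m.*2 = pi / 2 * (m.*2)`!%:R / (4 ^+ m * m`!%:R ^+ 2).
Proof.
elim: m => [|m ihm]; first by rewrite double0 wallis0 fact0; field.
rewrite doubleS wallisSS ihm !factS !natrM (exprS 4).
have e : m.*2%:R = 2 * m%:R :> R by rewrite -mul2n natrM.
have natS j : j.+1%:R = j%:R + 1 :> R by rewrite -natr1.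
rewrite (natS m.*2.+1) (natS m.*2) (natS m) e.
have f0 : m`!%:R != 0 :> R by rewrite pnatr_eq0 -lt0n fact_gt0.
have m0 : m%:R + 1 != 0 :> R by rewrite natr1 pnatr_eq0.
have m2 : 2 * m%:R + 1 + 1 != 0 :> R by rewrite -e -!natS pnatr_eq0.
have e4 : 4 ^+ m != 0 :> R by rewrite expf_neq0.
set F := _`!%:R in f0 *; set G := _`!%:R; set P := 4 ^+ m in e4 *.
move: f0 e4 m0 m2; generalize F G P (m%:R : R) => {}F {}G {}P x f0 e4 m0 m2.
by field; rewrite m2 f0 e4 m0.
Qed.

Lemma wallis_sqr_le m : (0 < m)%N -> wallis m.*2 ^+ 2 <= pi / (4 * m%:R).
Proof.
case: m => // m _; rewrite doubleS.
have := wallis_mul m.*2.+1; have := wallis_le m.*2.+1.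
have := wallis_gt0 m.*2.+2.
have -> : m.*2.+2%:R = 2 * m.+1%:R :> R by rewrite -doubleS -mul2n natrM.
set w := wallis _; set v := wallis _; set M := m.+1%:R => w0 wv e.
have M0 : 0 < M by rewrite ltr0n.
rewrite ler_pdivlMr ?mulr_gt0 //.
have : M * (w * w) <= M * (w * v) by rewrite !ler_pM2l.
by lra.
Qed.

Lemma wallis_sqr_ge m : pi / (2 * m.*2.+1%:R) <= wallis m.*2 ^+ 2.
Proof.
have := wallis_mul m.*2; have := wallis_le m.*2; have := wallis_gt0 m.*2.
set w := wallis _; set v := wallis _; set M := m.*2.+1%:R => w0 wv e.
have M0 : 0 < M by rewrite ltr0n.
rewrite ler_pdivrMr ?mulr_gt0 //.
have : M * (v * w) <= M * (w * w) by rewrite ler_pM2l // ler_pM2r.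
by lra.
Qed.

End Wallis.

(** * Bounds for the logarithm *)

Section LogBounds.
Context {R : realType}.

Lemma ln_prod (I : Type) (r : seq I) (F : I -> R) : (forall i, 0 < F i) ->
  ln (\prod_(i <- r) F i) = \sum_(i <- r) ln (F i).
Proof.
move=> F0; elim: r => [|i r ih]; first by rewrite !big_nil ln1.
by rewrite !big_cons lnM ?posrE ?prodr_gt0 // ih.
Qed.

Lemma ln_ratio_ge (t : R) : 0 <= t < 1 -> 2 * t <= ln (1 + t) - ln (1 - t).
Proof.
move=> /andP[t0 t1].
pose f (x : R) := ln (1 + x) - ln (1 - x) - 2 * x.
suff : f 0 <= f t by rewrite /f addr0 subr0 ln1; lra.
apply: (@derives_le R f
  (fun x => 2 * x ^+ 2 / ((1 + x) * (1 - x))) 0 t t0) => x /andP[x0 xt].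
  apply: derives_eq; first by derive_rules; lra.
  by rewrite /=; field; apply/andP; split; apply: lt0r_neq0; lra.
by rewrite divr_ge0 ?mulr_ge0 ?exprn_ge0 //; lra.
Qed.

(** The right-hand side dominates the series 2 (t + t^3/3 + t^5/5 + ...) by
    replacing all the denominators from 3 on by 3.  At t = 1/(2m+1) it
    produces the constant 1/12 of Stirling's formula. *)
Lemma ln_ratio_le (t : R) : 0 <= t < 1 ->
  ln (1 + t) - ln (1 - t) <= 2 * t + 2 * t ^+ 3 / (3 * (1 - t ^+ 2)).
Proof.
move=> /andP[t0 t1].
have -> : 2 * t + 2 * t ^+ 3 / (3 * (1 - t ^+ 2)) =
  4 / 3 * t + 3^-1 * ((1 - t)^-1 - (1 + t)^-1).
  by field; apply/and3P; split; apply: lt0r_neq0; nra.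
pose f (x : R) :=
  4 / 3 * x + 3^-1 * ((1 - x)^-1 - (1 + x)^-1) - (ln (1 + x) - ln (1 - x)).
suff : f 0 <= f t by rewrite /f addr0 subr0 ln1; lra.
apply: (@derives_le R f
  (fun x => 4 / 3 * x ^+ 4 / ((1 + x) * (1 - x)) ^+ 2) 0 t t0)
  => x /andP[x0 xt].
  apply: derives_eq; first by derive_rules; (try apply: lt0r_neq0); lra.
  by rewrite /=; field; apply/andP; split; apply: lt0r_neq0; lra.
by rewrite divr_ge0 ?mulr_ge0 ?exprn_ge0 //; lra.
Qed.

(** The remainder r has derivative -x^3 / (1 + x), and that of r + 2 x^4 is
    x^3 (8 - 1/(1 + x)); on x >= -7/8, where 1/(1 + x) <= 8, their signs are
    those of -x and x, and both functions vanish at 0. *)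
Lemma ln1D_taylor (u : R) : - (7 / 8) <= u ->
  - (2 * u ^+ 4) <= ln (1 + u) - (u - u ^+ 2 / 2 + u ^+ 3 / 3) <= 0.
Proof.
move=> u1.
pose r c (x : R) := ln (1 + x) - (x - x ^+ 2 / 2 + x ^+ 3 / 3) + c * x ^+ 4.
pose s c (x : R) := x ^+ 3 * (4 * c - (1 + x)^-1).
have dr (c x : R) : - (7 / 8) <= x -> derives (r c) x (s c x).
  move=> x1; apply: derives_eq; first by derive_rules; lra.
  by rewrite /s /=; field; apply: lt0r_neq0; lra.
have drN (c x : R) : - (7 / 8) <= x -> derives (fun t => - r c t) x (- s c x).
  by move=> x1; apply: derivesN; exact: dr.
have r0 c : r c 0 = 0 by rewrite /r addr0 ln1; ring.
have iv (x : R) : - (7 / 8) <= x -> 0 < (1 + x)^-1 <= 8.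
  move=> x1; have y0 : 0 < 1 + x by lra.
  by rewrite invr_gt0 y0 -div1r ler_pdivrMr //=; lra.
suff : r 0 u <= 0 /\ 0 <= r 2 u by rewrite /r; lra.
have [u0|u0] := leP 0 u.
- split.
    suff : - r 0 0 <= - r 0 u by rewrite r0; lra.
    apply: (@derives_le R (fun t => - r 0 t) (fun t => - s 0 t) 0 u u0)
      => x /andP[x0 xu].
      by apply: drN; lra.
    rewrite -mulrN mulr_ge0 ?exprn_ge0 //.
    by have := iv x ltac:(lra); lra.
  suff : r 2 0 <= r 2 u by rewrite r0.
  apply: (@derives_le R (r 2) (s 2) 0 u u0) => x /andP[x0 xu].
    by apply: dr; lra.
  rewrite mulr_ge0 ?exprn_ge0 //.
  by have := iv x ltac:(lra); lra.
have x3 (x : R) : x <= 0 -> x ^+ 3 <= 0.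
  by move=> x0; rewrite exprS mulr_le0_ge0 // exprn_even_ge0.
split.
  suff : r 0 u <= r 0 0 by rewrite r0.
  apply: (@derives_le R (r 0) (s 0) u 0 (ltW u0)) => x /andP[x0 xu].
    by apply: dr; lra.
  rewrite mulr_le0 ?x3 //.
  by have := iv x ltac:(lra); lra.
suff : - r 2 u <= - r 2 0 by rewrite r0; lra.
apply: (@derives_le R (fun t => - r 2 t) (fun t => - s 2 t) u 0 (ltW u0))
  => x /andP[x0 xu].
  by apply: drN; lra.
rewrite -mulNr mulr_ge0 ?oppr_ge0 ?x3 //.
by have := iv x ltac:(lra); lra.
Qed.

(** The maximum of ln x / sqrt x is 2/e, and e >= 128/49.  Concavity is used
    through ln (y/a) <= y/a - 1 with y = sqrt x and a = 128/49, for which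
    ln a <= 1. *)
Lemma ln_le_sqrt (x : R) : 1 <= x -> ln x <= 49 / 64 * Num.sqrt x.
Proof.
move=> x1; set y := Num.sqrt x.
have x0 : 0 < x by lra.
have y0 : 0 < y by rewrite sqrtr_gt0.
have -> : ln x = 2 * ln y by rewrite mulr_natl -lnXn // sqr_sqrtr // ltW.
have l1 : ln (1 + y * (49 / 128) - 1) <= y * (49 / 128) - 1.
  by rewrite -addrA; apply: le_ln1Dx; nra.
have l2 : ln (128 / 49) <= 1 :> R.
  (* (17/16)^16 is about 2.638, between 128/49 and e. *)
  have : ln (128 / 49) <= ln ((1 + 16^-1) ^+ 16) :> R.
    by rewrite ler_ln ?posrE ?exprn_gt0 //; lra.
  rewrite lnXn; last by lra.
  have : ln (1 + 16^-1) <= 16^-1 :> R by apply: le_ln1Dx; lra.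
  by rewrite -mulr_natl; lra.
have e : y = (y * (49 / 128)) * (128 / 49) by field.
have l3 : ln y = ln (y * (49 / 128)) + ln (128 / 49).
  by rewrite {1}e lnM ?posrE //; lra.
rewrite l3; move: l1; rewrite (_ : 1 + _ - 1 = y * (49 / 128)); last by ring.
by lra.
Qed.

Lemma norm_ln1D_sub (u : R) : `|u| <= 7 / 8 ->
  `|ln (1 + u) - u| <= 20 * `|u| ^+ 2.
Proof.
move=> hu; have := hu; rewrite ler_norml => /andP[u1 u2].
rewrite -normrX [X in 20 * X]ger0_norm ?exprn_even_ge0 // ler_norml.
have v0 : 0 <= u ^+ 2 by rewrite exprn_even_ge0.
have v1 : u ^+ 2 <= 1.
  by rewrite -real_normK ?num_real // exprn_ile1 ?normr_ge0 //; lra.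
have v3 : - u ^+ 2 <= u ^+ 3.
  by rewrite exprS -mulN1r ler_wpM2r //; lra.
have v4 : u ^+ 4 <= u ^+ 2.
  by rewrite (exprD _ 2 2) -[leRHS]mulr1 ler_wpM2l.
have lu : ln (1 + u) <= u by apply: le_ln1Dx; lra.
have := ln1D_taylor _ u1.
by lra.
Qed.

(** With r the remainder of [ln1D_taylor], the left-hand side is
    (1 + u) r + u^4 / 3: multiplying by 1 + u the cubic Taylor polynomial of
    ln (1 + u) leaves only u^4 / 3 in degree four. *)
Lemma norm_entropy_remainder (u : R) : `|u| <= 7 / 8 ->
  `|(1 + u) * ln (1 + u) - (u + u ^+ 2 / 2 - u ^+ 3 / 6)| <= 21 * `|u| ^+ 4.
Proof.
move=> hu; have := hu; rewrite ler_norml => /andP[u1 u2].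
rewrite -normrX [X in 21 * X]ger0_norm ?exprn_even_ge0 // ler_norml.
have := ln1D_taylor _ u1.
set r := ln _ - _ => hr.
have -> : ln (1 + u) = r + (u - u ^+ 2 / 2 + u ^+ 3 / 3) by rewrite /r subrK.
have -> : (1 + u) * (r + (u - u ^+ 2 / 2 + u ^+ 3 / 3))
    - (u + u ^+ 2 / 2 - u ^+ 3 / 6)
   = (1 + u) * r + u ^+ 4 / 3 by field.
have u4 : 0 <= u ^+ 4 by rewrite exprn_even_ge0.
have u10 : 0 <= 1 + u by lra.
have [/andP[r1 r2]] : - (2 * u ^+ 4) <= r <= 0 by [].
have := ler_wpM2l u10 r1; have := ler_wpM2l u10 r2.
have : (1 + u) * (2 * u ^+ 4) <= 2 * (2 * u ^+ 4) by rewrite ler_wpM2r //; lra.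
by lra.
Qed.

End LogBounds.

(** * Stirling's formula with error bounds *)

Section Stirling.
Context {R : realType}.

Definition stirling_err (m : nat) : R :=
  ln m`!%:R - ((m%:R + 2^-1) * ln m%:R - m%:R + ln (2 * pi) / 2).

(** The difference is (m + 1/2) (ln (m+1) - ln m) - 1, and
    (m+1)/m = (1 + t)/(1 - t) for t = 1/(2m+1). *)
Lemma stirling_err_step (m : nat) : (0 < m)%N ->
  0 <= stirling_err m - stirling_err m.+1 <= (12 * m%:R)^-1 - (12 * m.+1%:R)^-1.
Proof.
move=> m0; have M0 : 0 < m%:R :> R by rewrite ltr0n.
have eS : m.+1%:R = m%:R + 1 :> R by rewrite -natr1.
have -> : stirling_err m - stirling_err m.+1 =
    (m%:R + 2^-1) * (ln (m%:R + 1) - ln m%:R) - 1.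
  rewrite /stirling_err factS natrM.
  rewrite [ln (_ * m`!%:R)]lnM ?posrE ?ltr0n ?fact_gt0 // eS.
  by ring.
rewrite eS; set x := m%:R in M0 *; rename M0 into x0.
pose t := (2 * x + 1)^-1.
have t01 : 0 <= t < 1 by rewrite invr_ge0 invf_lt1; lra.
have -> : ln (x + 1) - ln x = ln (1 + t) - ln (1 - t).
  have -> : 1 + t = 2 * (x + 1) / (2 * x + 1).
    by rewrite /t; field; apply: lt0r_neq0; lra.
  have -> : 1 - t = 2 * x / (2 * x + 1).
    by rewrite /t; field; apply: lt0r_neq0; lra.
  have x21 : 0 < 2 * x + 1 by lra.
  rewrite !ln_div ?posrE ?mulr_gt0 //; try lra.
  by rewrite !lnM ?posrE //; lra.
have := ln_ratio_ge _ t01; have := ln_ratio_le _ t01.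
set D := ln _ - ln _ => hi lo.
have xh : 0 <= x + 2^-1 by lra.
have := ler_wpM2l xh lo; have := ler_wpM2l xh hi.
have -> : (x + 2^-1) * (2 * t) = 1.
  by rewrite /t; field; apply: lt0r_neq0; lra.
have -> : (x + 2^-1) * (2 * t + 2 * t ^+ 3 / (3 * (1 - t ^+ 2))) =
    1 + ((12 * x)^-1 - (12 * (x + 1))^-1).
  rewrite /t; field.
  by rewrite (_ : _ - 1 = 4 * (x * (x + 1))); last ring;
     rewrite !mulf_neq0 ?lt0r_neq0 //; lra.
by lra.
Qed.

Lemma stirling_err_mono (m j : nat) : (0 < m)%N ->
  0 <= stirling_err m - stirling_err (m + j) <=
    (12 * m%:R)^-1 - (12 * (m + j)%:R)^-1.
Proof.
move=> m0; elim: j => [|j ihj]; first by rewrite addn0 !subrr lexx.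
have := stirling_err_step (m + j) (ltn_addr j m0).
rewrite addnS; move: ihj.
set a := (12 * (m + j)%:R)^-1; set b := (12 * (m + j).+1%:R)^-1.
by lra.
Qed.

(** The enclosure of W_(2m)^2 in logarithmic form; the constant
    ln (2 pi) / 2 in the definition of the error is the one that makes the
    terms without 1/m disappear here. *)
Lemma stirling_err_double (m : nat) : (0 < m)%N ->
  - (4 * m%:R)^-1 <= stirling_err m.*2 - 2 * stirling_err m <= 0.
Proof.
move=> m0; have M0 : 0 < m%:R :> R by rewrite ltr0n.
have p0 := @pi_gt0 R.
have e2 : m.*2%:R = 2 * m%:R :> R by rewrite -mul2n natrM.
have f0 j : 0 < j`!%:R :> R by rewrite ltr0n fact_gt0.
have w0 := @wallis_gt0 R m.*2.
have l4 : ln 4 = 2 * ln 2 :> R.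
  by rewrite (_ : 4 = 2 ^+ 2); [rewrite lnXn // mulr_natl | ring].
have lw : ln (wallis m.*2) = (ln pi - ln m%:R) / 2 - ln 2
    + (stirling_err m.*2 - 2 * stirling_err m) :> R.
  have -> : stirling_err m.*2 - 2 * stirling_err m =
      ln (m.*2)`!%:R - 2 * ln m`!%:R - 2 * m%:R * ln 2
      + (ln m%:R + ln pi) / 2.
    by rewrite /stirling_err e2 !lnM ?posrE //; field.
  rewrite wallis_double ln_div ?posrE ?mulr_gt0 ?exprn_gt0 ?divr_gt0 //.
  rewrite lnM ?posrE ?divr_gt0 // ln_div ?posrE //.
  rewrite lnM ?posrE ?exprn_gt0 // !lnXn //.
  rewrite l4. by field.
have lw2 : ln (wallis m.*2 ^+ 2) = 2 * ln (wallis m.*2) :> R.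
  by rewrite lnXn // mulr_natl.
have := @wallis_sqr_ge R m; have := @wallis_sqr_le R m m0.
rewrite -ler_ln ?posrE ?exprn_gt0 ?divr_gt0 ?mulr_gt0 // => hi.
rewrite -ler_ln ?posrE ?exprn_gt0 ?divr_gt0 ?mulr_gt0 // => lo.
rewrite lw2 lw ln_div ?posrE ?mulr_gt0 // lnM ?posrE // l4 in hi.
rewrite lw2 lw ln_div ?posrE ?mulr_gt0 // lnM ?posrE // in lo.
have l1 : ln m.*2.+1%:R <= ln 2 + ln m%:R + (2 * m%:R)^-1 :> R.
  rewrite -natr1 e2 (_ : _ + 1 = 2 * m%:R * (1 + (2 * m%:R)^-1)); last first.
    by field; exact: lt0r_neq0.
  have i0 : 0 < (2 * m%:R)^-1 :> R by rewrite invr_gt0 mulr_gt0.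
  rewrite lnM ?posrE ?mulr_gt0 ?addr_gt0 //.
  rewrite lnM ?posrE // lerD2l.
  by apply: le_ln1Dx; apply: lt_trans i0; rewrite ltrN10.
have q : (4 * m%:R)^-1 = (2 * m%:R)^-1 / 2 :> R by field; exact: lt0r_neq0.
by rewrite q; lra.
Qed.

(** e_m = (e_(2m) - e_m) - (e_(2m) - 2 e_m), and both brackets are of
    order 1/m. *)
Lemma stirling_err_crude (m : nat) : (0 < m)%N ->
  - (4 * m%:R)^-1 <= stirling_err m <= (4 * m%:R)^-1.
Proof.
move=> m0; have M0 : 0 < m%:R :> R by rewrite ltr0n.
have := stirling_err_double m m0; have := stirling_err_mono m m m0.
rewrite addnn (_ : m.*2%:R = 2 * m%:R :> R); last by rewrite -mul2n natrM.
have i0 : 0 < m%:R^-1 :> R by rewrite invr_gt0.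
by rewrite !invfM; lra.
Qed.

(** Both e_m - e_(m+j) and 1/(12 m) - 1/(12 (m+j)) - (e_m - e_(m+j)) are
    nonnegative, and e_(m+j) is as small as desired for large j. *)
Lemma stirling_bounds (m : nat) : (0 < m)%N ->
  0 <= stirling_err m <= (12 * m%:R)^-1.
Proof.
move=> m0; have M0 : 0 < m%:R :> R by rewrite ltr0n.
(* Letting j grow costs an arbitrarily small e. *)
suff arch (e : R) : 0 < e ->
    - e <= stirling_err m <= (12 * m%:R)^-1 + e.
  apply/andP; split; apply/ler_addgt0Pr => e /arch; lra.
move=> e0.
have [j je] : exists j : nat, e^-1 <= j%:R.
  by exists (Num.bound e^-1); apply/ltW/archi_boundP; rewrite invr_ge0 ltW.
have mj0 : (0 < m + j)%N by rewrite addn_gt0 m0.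
have := stirling_err_mono m j m0; have := stirling_err_crude (m + j) mj0.
have : 0 < ((m + j)%:R : R)^-1 <= e.
  have mjR : 0 < (m + j)%:R :> R by rewrite ltr0n.
  rewrite invr_gt0 mjR /= -div1r ler_pdivrMr // -ler_pdivrMl // mulr1.
  by rewrite natrD; lra.
by rewrite !invfM; lra.
Qed.

End Stirling.

(** * The completed vectors and the Gaussian exponent *)

Section Extended.

Lemma extend_widen (T : Type) (d : nat) (s : 'cV[T]_d) (t : T) (i : 'I_d) :
  extend s t (widen_ord (leqnSn d) i) = s i 0.
Proof.
rewrite /extend (_ : widen_ord _ i = lift ord_max i) ?liftK //.
by apply: val_inj; rewrite /= /bump leqNgt ltn_ord.
Qed.

Lemma extend_max (T : Type) (d : nat) (s : 'cV[T]_d) (t : T) :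
  extend s t ord_max = t.
Proof. by rewrite /extend unlift_none. Qed.

Context {R : realType} {d : nat}.
Implicit Types (p s : 'cV[R]_d) (k : 'cV[nat]_d).

Lemma norm1_simplex s : simplex_interior s -> norm1 s = \sum_(i < d) s i 0.
Proof.
move=> [s01 _]; apply: eq_bigr => i _.
by rewrite gtr0_norm //; case/andP: (s01 i).
Qed.

Lemma prob_ext_gt0 p (i : 'I_d.+1) : simplex_interior p -> 0 < prob_ext p i.
Proof.
move=> [p01 p1]; rewrite /prob_ext /extend.
by case: unliftP => [j _|_]; [case/andP: (p01 j) | rewrite subr_gt0].
Qed.

Lemma sum_prob_ext p : simplex_interior p -> \sum_(i < d.+1) prob_ext p i = 1.
Proof.
move=> hp; rewrite big_ord_recr /= /prob_ext extend_max norm1_simplex //.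
by under eq_bigr do rewrite extend_widen; rewrite addrC subrK.
Qed.

Lemma scaled_simplex_counts (n : nat) k : (0 < n)%N ->
  ((fun s : 'cV[R]_d => n%:R *: s) @` (@simplex_interior R d)) (real_vec R k) ->
  (\sum_(i < d) k i ord0 < n)%N /\ forall i, (0 < k i ord0)%N.
Proof.
move=> n0 [s hs e].
have ks i : (k i ord0)%:R = n%:R * s i 0 :> R.
  by have := congr1 (fun v : 'cV[R]_d => v i 0) e; rewrite !mxE => ->.
have [s01 s1] := hs; rewrite norm1_simplex // in s1.
have sum_ks : (\sum_(i < d) k i ord0)%:R = n%:R * \sum_(i < d) s i 0 :> R.
  by rewrite natr_sum mulr_sumr; apply: eq_bigr => i _.
split.
  by rewrite -(ltr_nat R) sum_ks gtr_pMr // ltr0n.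
by move=> i; rewrite -(ltr_nat R) ks mulr_gt0 ?ltr0n //; case/andP: (s01 i).
Qed.

Lemma count_ext_gt0 (n : nat) k (i : 'I_d.+1) :
  (\sum_(i < d) k i ord0 < n)%N -> (forall i, 0 < k i ord0)%N ->
  (0 < count_ext n k i)%N.
Proof.
move=> kn k0; rewrite /count_ext /extend.
by case: unliftP => [j _|_]; [exact: k0 | rewrite subn_gt0].
Qed.

Lemma sum_count_ext (n : nat) k : (\sum_(i < d) k i ord0 <= n)%N ->
  (\sum_(i < d.+1) count_ext n k i = n)%N.
Proof.
move=> kn; rewrite big_ord_recr /= /count_ext extend_max.
by under eq_bigr do rewrite extend_widen; rewrite subnKC.
Qed.

(** Sherman-Morrison for a rank-one perturbation of a diagonal matrix. *)
Lemma invmx_Sigma p : simplex_interior p ->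
  invmx (Sigma p) =
    diag_mx (\row_i (p i 0)^-1) + (prob_ext p ord_max)^-1 *: const_mx 1.
Proof.
move=> hp; set q := prob_ext p ord_max; set E := diag_mx _.
have q0 : q != 0 by rewrite gt_eqF ?prob_ext_gt0.
have pi0 i : p i 0 != 0.
  by rewrite gt_eqF //; case: hp => /(_ i) /andP[].
pose u : 'cV[R]_d := const_mx 1.
have uu : const_mx 1 = u *m u^T :> 'M[R]_d.
  by apply/matrixP => i j; rewrite !mxE big_ord1 !mxE mulr1.
have DE : diag_mx p^T *m E = 1%:M.
  rewrite mulmx_diag; apply/matrixP => i j; rewrite !mxE.
  by case: eqP => _; rewrite ?mulr0n // !mulr1n mulfV.
have Du : diag_mx p^T *m u = p.
  by apply/matrixP => i j; rewrite mul_diag_mx !mxE mulr1 ord1.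
have pE : p^T *m E = u^T.
  by apply/matrixP => i j; rewrite mul_mx_diag !mxE ord1 mulfV.
have pu : p^T *m u = (1 - q)%:M.
  apply/matrixP => i j; rewrite !ord1 !mxE mulr1n /q /prob_ext extend_max.
  rewrite norm1_simplex // subKr; apply: eq_bigr => l _.
  by rewrite !mxE mulr1.
have SA : Sigma p *m (E + q^-1 *: const_mx 1) = 1%:M.
  rewrite uu /Sigma mulmxDr mulmxBl DE -mulmxA pE -scalemxAr.
  rewrite mulmxA mulmxBl Du -(mulmxA p) pu mul_mx_scalar.
  have -> : p - (1 - q) *: p = q *: p by rewrite scalerBl scale1r subKr.
  rewrite -scalemxAl scalerA mulVf // scale1r.
  by rewrite subrK.
have [Su _] := mulmx1_unit SA.
by rewrite -[RHS](mulKmx Su) SA mulmx1.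
Qed.

Lemma quadratic_form_Sigma p (y : 'cV[R]_d) : simplex_interior p ->
  (y^T *m invmx (Sigma p) *m y) 0 0 =
    \sum_(i < d) y i 0 ^+ 2 / p i 0
      + (\sum_(i < d) y i 0) ^+ 2 / prob_ext p ord_max.
Proof.
move=> hp; rewrite invmx_Sigma // mulmxDr mulmxDl mxE; congr (_ + _).
  rewrite mul_mx_diag mxE; apply: eq_bigr => i _; rewrite !mxE; ring.
rewrite -scalemxAr -scalemxAl mxE mulrC expr2; congr (_ / _).
rewrite mxE mulr_sumr; apply: eq_bigr => i _; rewrite !mxE; congr (_ * _).
by apply: eq_bigr => j _; rewrite !mxE mulr1.
Qed.

(** The last coordinate absorbs the rank-one part of the inverse, because
    the completed deviations add up to 0. *)
Lemma gauss_exponent (n : nat) p k : (0 < n)%N -> simplex_interior p ->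
  (\sum_(i < d) k i ord0 <= n)%N ->
  ((delta_vec n (real_vec R k) p)^T *m invmx (Sigma p)
     *m delta_vec n (real_vec R k) p) 0 0 =
  \sum_(i < d.+1) delta_ext n k p i ^+ 2 / prob_ext p i.
Proof.
move=> n0 hp kn; rewrite quadratic_form_Sigma // big_ord_recr /=; congr (_ + _).
  apply: eq_bigr => i _.
  by rewrite /delta_ext /prob_ext /count_ext !extend_widen !mxE.
congr (_ / _).
have -> : \sum_(i < d) delta_vec n (real_vec R k) p i 0 =
    - delta_ext n k p ord_max.
  have -> : \sum_(i < d) delta_vec n (real_vec R k) p i 0 =
      \sum_(i < d) delta_ext n k p (widen_ord (leqnSn d) i).
    apply: eq_bigr => i _.
    by rewrite /delta_ext /prob_ext /count_ext !extend_widen !mxE.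
  apply/eqP; rewrite -addr_eq0 -(big_ord_recr d) /=; apply/eqP.
  rewrite /delta_ext /delta -mulr_suml sumrB -natr_sum sum_count_ext //.
  by rewrite -mulr_sumr sum_prob_ext // mulr1 subrr mul0r.
by rewrite sqrrN.
Qed.

End Extended.

(** * Expansion of the log-ratio *)

(** The relative deviation (k_i - n p_i) / (n p_i), in the form in which the
    bulk bounds it. *)
Definition rel_dev {R : realType} {d : nat} (n : nat) (k : 'cV[nat]_d)
    (p : 'cV[R]_d) (i : 'I_d.+1) : R :=
  delta_ext n k p i / (Num.sqrt n%:R * prob_ext p i).

Section Expansion.
Context {R : realType} {d n : nat} {p : 'cV[R]_d} {k : 'cV[nat]_d}.
Context (n0 : (0 < n)%N) (hp : simplex_interior p).
Context (kn : (\sum_(i < d) k i ord0 < n)%N) (k0 : forall i, (0 < k i ord0)%N).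

Local Notation N := (n%:R : R).
Local Notation q := (prob_ext p).
Local Notation c := (count_ext n k).
Local Notation u := (rel_dev n k p).
Local Notation dl := (delta_ext n k p).

Let N0 : 0 < N. Proof. by rewrite ltr0n. Qed.
Let sN0 : 0 < Num.sqrt N. Proof. by rewrite sqrtr_gt0. Qed.
Let q0 i : 0 < q i. Proof. exact: prob_ext_gt0. Qed.
Let c0 i : (0 < c i)%N. Proof. exact: count_ext_gt0. Qed.
Let cR0 i : 0 < (c i)%:R :> R. Proof. by rewrite ltr0n. Qed.
Let sqN : Num.sqrt N ^+ 2 = N. Proof. by rewrite sqr_sqrtr // ltW. Qed.

Lemma delta_ext_rel_dev i : dl i = Num.sqrt N * q i * u i.
Proof.
by rewrite /rel_dev mulrCA mulfV ?mulr1 // mulf_neq0 // gt_eqF.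
Qed.

Lemma count_ext_rel_dev i : (c i)%:R = N * q i * (1 + u i).
Proof.
have : (c i)%:R - N * q i = Num.sqrt N * dl i.
  by rewrite /delta_ext /delta mulrCA mulfV ?mulr1 // gt_eqF.
rewrite delta_ext_rel_dev => e.
by rewrite -[LHS](subrK (N * q i)) e -[in RHS]sqN -[X in _ + X * _]sqN; ring.
Qed.

Lemma rel_dev_gtN1 i : 0 < 1 + u i.
Proof.
by rewrite -(pmulr_rgt0 _ (mulr_gt0 N0 (q0 i))) -count_ext_rel_dev.
Qed.

Lemma sum_rel_dev : \sum_(i < d.+1) N * q i * u i = 0.
Proof.
have : \sum_(i < d.+1) (c i)%:R = N by rewrite -natr_sum sum_count_ext // ltnW.
under eq_bigr do rewrite count_ext_rel_dev mulrDr mulr1.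
by rewrite big_split /= -mulr_sumr sum_prob_ext // mulr1; lra.
Qed.

Lemma ln_fact_stirling (m : nat) : ln m`!%:R =
  (m%:R + 2^-1) * ln m%:R - m%:R + ln (2 * pi) / 2 + stirling_err m :> R.
Proof. by rewrite /stirling_err; ring. Qed.

(** What the i-th coordinate loses when (1 + u) ln (1 + u) is cut after the
    cubic term and ln (1 + u) after the linear one. *)
Definition taylor_rest i : R :=
  N * q i * ((1 + u i) * ln (1 + u i) - (u i + u i ^+ 2 / 2 - u i ^+ 3 / 6))
  + (ln (1 + u i) - u i) / 2.

Lemma ln_pmf : ln (multinomial_pmf n p k) =
  ln n`!%:R + \sum_(i < d.+1) ((c i)%:R * ln (q i) - ln (c i)`!%:R).
Proof.
have f0 m : 0 < m`!%:R :> R by rewrite ltr0n fact_gt0.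
rewrite /multinomial_pmf lnM ?posrE ?divr_gt0 ?prodr_gt0 //; last first.
  by move=> i _; rewrite exprn_gt0.
rewrite ln_div ?posrE ?prodr_gt0 // !ln_prod //; last first.
  by move=> i; rewrite exprn_gt0.
rewrite sumrB -addrA [X in _ + X]addrC; congr (_ + (_ - _)).
by apply: eq_bigr => i _; rewrite lnXn // mulr_natl.
Qed.

Lemma ln_gauss : ln (gauss_density p (delta_vec n (real_vec R k) p)) =
  - (d%:R * ln (2 * pi) / 2)
  - \sum_(i < d.+1) (dl i ^+ 2 / q i / 2 + ln (q i) / 2).
Proof.
have p0 := @pi_gt0 R.
have Q0 : 0 < \prod_(i < d.+1) q i by rewrite prodr_gt0.
have P0 : 0 < (2 * pi) ^+ d * \prod_(i < d.+1) q i.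
  by rewrite mulr_gt0 // exprn_gt0 // mulr_gt0.
rewrite /gauss_density gauss_exponent //; last exact: ltnW.
rewrite ln_div ?posrE ?expR_gt0 ?sqrtr_gt0 // expRK.
rewrite -powR12_sqrt ?ltW // ln_powR lnM ?posrE ?exprn_gt0 ?mulr_gt0 //.
rewrite lnXn ?mulr_gt0 // ln_prod // big_split /= -!mulr_suml -mulr_natl.
by field.
Qed.

(** Coordinate by coordinate, the two sides differ by terms in k_i, by a
    constant and by n p_i u_i.  Summed, these become n (ln n - 1), d + 1 times
    the constant and 0, which Stirling's formula for n! compensates. *)
Lemma log_ratio_eq :
  ln (multinomial_pmf n p k /
      (N `^ (- (d%:R / 2)) * gauss_density p (delta_vec n (real_vec R k) p))) =
  N `^ (- 2^-1) * \sum_(i < d.+1)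
     (1 / (6 * q i ^+ 2) * dl i ^+ 3 - 1 / (2 * q i) * dl i)
  + (stirling_err n - \sum_(i < d.+1) (stirling_err (c i) + taylor_rest i)).
Proof.
have f0 m : 0 < m`!%:R :> R by rewrite ltr0n fact_gt0.
have p0 := @pi_gt0 R.
have pmf0 : 0 < multinomial_pmf n p k.
  rewrite mulr_gt0 ?divr_gt0 ?prodr_gt0 // => i _; exact: exprn_gt0.
have g0 : 0 < gauss_density p (delta_vec n (real_vec R k) p).
  rewrite divr_gt0 ?expR_gt0 // sqrtr_gt0 mulr_gt0 ?prodr_gt0 //.
  by rewrite exprn_gt0 ?mulr_gt0.
have r0 : 0 < N `^ (- (d%:R / 2)) by rewrite powR_gt0.
rewrite (ln_div pmf0 (mulr_gt0 r0 g0)) (lnM r0 g0).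
rewrite ln_powR ln_pmf ln_gauss powRN powR12_sqrt ?ltW // mulr_sumr.
pose M i := (Num.sqrt N)^-1 *
  (1 / (6 * q i ^+ 2) * dl i ^+ 3 - 1 / (2 * q i) * dl i).
pose L := ln N / 2 + ln (2 * pi) / 2.
(* L collects what each coordinate contributes to the Gaussian normalisation. *)
have term i : (c i)%:R * ln (q i) - ln (c i)`!%:R
      + (dl i ^+ 2 / q i / 2 + ln (q i) / 2)
   = M i - (stirling_err (c i) + taylor_rest i)
     + (- (c i)%:R * (ln N - 1) - L - N * q i * u i).
  have lc : ln (c i)%:R = ln N + ln (q i) + ln (1 + u i) :> R.
    rewrite count_ext_rel_dev !lnM ?posrE ?mulr_gt0 ?rel_dev_gtN1 //.
  have -> : M i = N * q i * u i ^+ 3 / 6 - u i / 2.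
    rewrite /M delta_ext_rel_dev -[in RHS]sqN; field.
    by rewrite !gt_eqF.
  have -> : dl i ^+ 2 / q i / 2 = N * q i * u i ^+ 2 / 2.
    by rewrite delta_ext_rel_dev -[in RHS]sqN; field; rewrite gt_eqF.
  rewrite ln_fact_stirling lc /taylor_rest /L count_ext_rel_dev.
  by field.
have sum_c : \sum_(i < d.+1) (c i)%:R = N.
  by rewrite -natr_sum sum_count_ext // ltnW.
have tot : \sum_(i < d.+1) ((c i)%:R * ln (q i) - ln (c i)`!%:R)
    + \sum_(i < d.+1) (dl i ^+ 2 / q i / 2 + ln (q i) / 2)
  = \sum_(i < d.+1) M i - \sum_(i < d.+1) (stirling_err (c i) + taylor_rest i)
    - N * (ln N - 1) - d.+1%:R * L.
  rewrite -big_split /= (eq_bigr _ (fun i _ => term i)) big_split /= sumrB.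
  have -> : \sum_(i < d.+1) (- (c i)%:R * (ln N - 1) - L - N * q i * u i) =
      - (N * (ln N - 1)) - d.+1%:R * L.
    rewrite !sumrB sum_rel_dev subr0 -mulr_suml sumrN sum_c mulNr.
    by rewrite sumr_const card_ord -[L *+ _]mulr_natl.
  by rewrite addrA.
move: tot; rewrite /M.
rewrite (ln_fact_stirling n) (_ : d.+1%:R = d%:R + 1 :> R) ?natr1 // /L.
by lra.
Qed.

End Expansion.

(** Squared, the bulk condition is u^2 <= tau^2 ln n / n, where
    tau^2 <= sqrt n and ln n <= (49/64) sqrt n. *)
Lemma rel_dev_le (R : realType) (d n : nat) (tau : R) (p : 'cV[R]_d)
    (k : 'cV[nat]_d) :
  (0 < n)%N -> 0 <= tau -> tau ^+ 4 <= n%:R -> bulk tau n p k ->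
  forall i, `|rel_dev n k p i| <= 7 / 8.
Proof.
move=> n0 tau0 hn [_ hk] i.
have {}hk : `|rel_dev n k p i| <= tau * Num.sqrt (ln n%:R / n%:R).
  by apply: le_trans hk; exact: le_bigmax.
apply: (le_trans hk).
have N0 : 0 < n%:R :> R by rewrite ltr0n.
have N1 : 1 <= n%:R :> R by rewrite ler1n.
have s0 := ln_le_sqrt _ N1.
have sq0 : 0 < Num.sqrt n%:R :> R by rewrite sqrtr_gt0.
have sqN : Num.sqrt n%:R ^+ 2 = n%:R :> R by rewrite sqr_sqrtr // ltW.
have t2 : tau ^+ 2 <= Num.sqrt n%:R.
  by rewrite -(ler_pXn2r (n := 2)) ?nnegrE ?exprn_ge0 ?sqrtr_ge0 // sqN -exprM.
have l0 : 0 <= ln n%:R / n%:R :> R by rewrite divr_ge0 ?ln_ge0 // ltW.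
rewrite -(ler_pXn2r (n := 2)) ?nnegrE ?mulr_ge0 ?sqrtr_ge0 //.
rewrite exprMn sqr_sqrtr // mulrA ler_pdivrMr // -[n%:R in leRHS]sqN.
have := ler_pM (exprn_ge0 2 tau0) (ln_ge0 N1) t2 s0.
by lra.
Qed.

Theorem proposition2p4 (R : realType) (d : nat) (hd : (0 < d)%N)
    (tau : R) (htau : d.+1%:R <= tau)
    (n : nat) (hn0 : (0 < n)%N) (hn : tau ^+ 4 <= n%:R)
    (p : 'cV[R]_d) (hp : param_set tau p)
    (k : 'cV[nat]_d) (hk : bulk tau n p k) :
  exists Rem : R,
    ln (multinomial_pmf n p k /
        (n%:R `^ (- (d%:R / 2)) * gauss_density p (delta_vec n (real_vec R k) p)))
    = n%:R `^ (- 2^-1) *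
        \sum_(i < d.+1)
          (1 / (6 * prob_ext p i ^+ 2) * delta_ext n k p i ^+ 3
           - 1 / (2 * prob_ext p i) * delta_ext n k p i)
      + Rem
    /\
    `|Rem| <= n%:R^-1 *
        \sum_(i < d.+1)
          (21 / prob_ext p i ^+ 3 * `|delta_ext n k p i| ^+ 4
           + 10 / prob_ext p i ^+ 2 * `|delta_ext n k p i| ^+ 2
           + 2 * tau / 3).
Proof.
have [hps hmax] := hp; have [hks _] := hk.
have [kn k0] := scaled_simplex_counts n k hn0 hks.
have N0 : 0 < n%:R :> R by rewrite ltr0n.
have tau1 : 1 <= tau by apply: le_trans htau; rewrite ler1n.
have tau0 : 0 < tau by lra.
have ule := rel_dev_le _ _ _ _ _ _ hn0 (ltW tau0) hn hk.
eexists; split; first exact: log_ratio_eq.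
have q0 i := prob_ext_gt0 p i hps.
have sqN : Num.sqrt n%:R ^+ 2 = n%:R :> R by rewrite sqr_sqrtr // ltW.
have s0 : 0 < Num.sqrt n%:R :> R by rewrite sqrtr_gt0.
pose E : R := n%:R^-1 * (2 * tau / 3).
have E0 : 0 <= E by rewrite mulr_ge0 ?invr_ge0 ?divr_ge0 ?mulr_ge0 // ltW.
(* One of the d + 1 copies of E also covers the error at n. *)
have err_n : 0 <= (stirling_err n : R) <= E.
  have /andP[h1 h2] := @stirling_bounds R n hn0.
  apply/andP; split; [exact: h1 | apply: (le_trans h2)].
  rewrite invfM mulrC ler_wpM2l ?invr_ge0 ?ltW //; lra.
have err_c (i : 'I_d.+1) : 0 <= (stirling_err (count_ext n k i) : R) <= E.
  have c0 := count_ext_gt0 n k i kn k0.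
  have /andP[h1 h2] := @stirling_bounds R _ c0.
  apply/andP; split; [exact: h1 | apply: (le_trans h2)].
  have qt : (prob_ext p i)^-1 <= tau by apply: le_trans hmax; exact: le_bigmax.
  have : 8^-1 <= 1 + rel_dev n k p i.
    by have := ule i; rewrite ler_norml; lra.
  move=> u8.
  have ab : (prob_ext p i)^-1 * (1 + rel_dev n k p i)^-1 <= tau * 8.
    have v0 : 0 < 1 + rel_dev n k p i by rewrite (lt_le_trans _ u8).
    have v8 : (1 + rel_dev n k p i)^-1 <= 8.
      by rewrite -[leRHS]invrK lef_pV2 ?posrE ?invr_gt0.
    by rewrite ler_pM ?invr_ge0 ?(ltW (q0 i)) ?(ltW v0).
  rewrite (count_ext_rel_dev hn0 hps) !invfM /E.
  have iN0 : 0 <= n%:R^-1 :> R by rewrite invr_ge0 ltW.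
  by have := ler_wpM2l iN0 ab; lra.
rewrite big_split /= opprD addrA.
apply: (le_trans (ler_normB _ _)).
rewrite mulr_sumr.
have -> : \sum_(i < d.+1) n%:R^-1 *
          (21 / prob_ext p i ^+ 3 * `|delta_ext n k p i| ^+ 4
           + 10 / prob_ext p i ^+ 2 * `|delta_ext n k p i| ^+ 2 + 2 * tau / 3) =
  \sum_(i < d.+1) E
  + \sum_(i < d.+1) (n%:R * prob_ext p i * (21 * `|rel_dev n k p i| ^+ 4)
     + 20 * `|rel_dev n k p i| ^+ 2 / 2).
  rewrite -big_split; apply: eq_bigr => i _ /=.
  rewrite (delta_ext_rel_dev hn0 hps).
  rewrite normrM (gtr0_norm (mulr_gt0 s0 (q0 i))) /E.
  move: s0 sqN; set s := Num.sqrt _ => s0 <-; field.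
  by rewrite !gt_eqF.
apply: lerD.
  rewrite ler_norml; apply/andP; split.
    have : \sum_(i < d.+1) stirling_err (count_ext n k i) <= \sum_(i < d.+1) E.
      by apply: ler_sum => i _; case/andP: (err_c i).
    by case/andP: err_n; lra.
  have h1 : 0 <= \sum_(i < d.+1) stirling_err (count_ext n k i) :> R.
    by apply: sumr_ge0 => i _; case/andP: (err_c i).
  have h2 : E <= \sum_(i < d.+1) E.
    by rewrite sumr_const card_ord mulrS lerDl mulrn_wge0.
  by case/andP: err_n; lra.
apply: (le_trans (ler_norm_sum _ _ _)); apply: ler_sum => i _.
apply: (le_trans (ler_normD _ _)); apply: lerD.
  rewrite normrM (gtr0_norm (mulr_gt0 N0 (q0 i))) ler_pM2l ?mulr_gt0 //.
  exact: norm_entropy_remainder.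
rewrite normrM [`|2^-1|]gtr0_norm // ler_pM2r //.
exact: norm_ln1D_sub.
Qed.
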